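(* Let $N$ be a positive integer such that $N\equiv 5\pmod 6$ and $N\notin\{5,11\}$. Then there exists an antipodal $5$-design with $2N+1$ rational points for the Chebyshev measure $(1-t^2)^{-1/2}dt/\pi$ on $(-1,1)$.
   Context: An $m$-design with $n$ points for a probability measure $w(t)dt$ on an interval $I$ is a set of $n$ pairwise distinct points $x_1,\dots,x_n\in I$ with $\frac1n\sum_i f(x_i)=\int_I f(t)w(t)dt$ for every real polynomial $f$ of degree at most $m$. It is rational if all $x_i\in\mathbb{Q}$ and antipodal if $\{x_i\}=\{-x_i\}$. *)

(* Defs.v *)
From HB Require Import structures.
From mathcomp Require Export all_boot all_order all_algebra.
From mathcomp Require Export all_classical all_reals all_analysis.

Set Implicit Arguments.
Unset Strict Implicit.
Unset Printing Implicit Defensive.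

Import Order.TTheory GRing.Theory Num.Theory.
Import numFieldNormedType.Exports.

Local Open Scope ring_scope.

(* The integral is the extended-real Lebesgue integral, so that the equation
   also forces its value to be finite. No separate hypothesis says that
   w(t)dt has mass 1: for n > 0 this is the case f = 1. *)
Definition is_design (R : realType) (w : R -> R) (I : interval R) (m n : nat)
    (x : n.-tuple R) : Prop :=
  [/\ uniq x,
      (forall i : 'I_n, tnth x i \in I) &
      forall f : {poly R}, (size f <= m.+1)%N ->
        ((n%:R^-1 * \sum_(i < n) f.[tnth x i])%:E =
         \int[lebesgue_measure]_(t in [set` I]) (f.[t] * w t)%:E)%E].

Definition rational_points (R : realType) (n : nat) (x : n.-tuple R) : Prop :=
  forall i : 'I_n, rational (tnth x i).

Definition antipodal (R : realType) (n : nat) (x : n.-tuple R) : Prop :=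
  x =i [seq - y | y <- x].

Definition chebyshev_density (R : realType) (t : R) : R :=
  (Num.sqrt (1 - t ^+ 2))^-1 / pi.

(* Main.v *)
(* A set symmetric about 0 has vanishing odd power sums, so 0 together with the
   points +-y, for y in a set s of N rationals in (0,1), is a 5-design as soon
   as the second and fourth power sums of s have the values prescribed by the
   moments of the Chebyshev measure. For N = 17 such a set is given explicitly.
   The positive projections of a regular hexagon inscribed in the unit circle
   have the right averages of squares and fourth powers; infinitely many of
   these hexagons have rational projections and they are pairwise disjoint, so N
   can always be increased by 3 with a hexagon that avoids the points in use.
   The moments obey n m_(n-1) = (n+1) m_(n+1), because t^n sqrt(1 - t^2)
   vanishes at -1 and 1. *)

Require Import Defs.
From mathcomp Require Import measurable_realfun ring lra zify.

Set Implicit Arguments.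
Unset Strict Implicit.
Unset Printing Implicit Defensive.

Import Order.TTheory GRing.Theory Num.Theory.
Import numFieldNormedType.Exports.

Local Open Scope classical_set_scope.
Local Open Scope ring_scope.

Section FTC_open_interval.
Context {R : realType}.
Notation mu := (@lebesgue_measure R).
Implicit Types (f F : R -> R) (a b : R).

Definition inner_itv a b (n : nat) : set R :=
  `[a + harmonic n, b - harmonic n].

Lemma inner_itv_subset a b n : inner_itv a b n `<=` `]a, b[.
Proof.
by apply: subset_itv; rewrite bnd_simp ?ltrDl ?gtrBl harmonic_gt0.
Qed.

Lemma itvoo_bigcup_inner_itv a b : `]a, b[%classic = \bigcup_n inner_itv a b n.
Proof.
apply/seteqP; split=> x; last by move=> [n _ /inner_itv_subset].
rewrite /= in_itv/= => /andP[ax xb].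
have [n] : exists n, harmonic n < Num.min (x - a) (b - x).
  apply: (@filter_ex _ \oo).
  by apply: (cvgr_lt 0 cvg_harmonic); rewrite lt_min !subr_gt0 ax.
rewrite lt_min => /andP[nx nb]; exists n => //.
by rewrite /inner_itv/= in_itv/= lerBrDl -lerBrDr -lerBrDl !ltW.
Qed.

Lemma nondecreasing_inner_itv a b : nondecreasing_seq (inner_itv a b).
Proof.
apply/nondecreasing_seqP => n; rewrite subsetEset.
have harmonicS : harmonic n.+1 <= harmonic n :> R.
  by rewrite lef_pV2 ?posrE ?ltr0n// ler_nat.
by apply: subset_itv; rewrite bnd_simp lerD2l ?lerN2.
Qed.

Lemma ge0_cvg_integral_inner_itv (f : R -> \bar R) a b :
  measurable_fun `]a, b[ f -> {in `]a, b[, forall x, (0 <= f x)%E} ->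
  (\int[mu]_(x in inner_itv a b n) f x)%E @[n --> \oo] -->
  (\int[mu]_(x in `]a, b[) f x)%E.
Proof.
move=> mf f0; rewrite itvoo_bigcup_inner_itv.
apply: ge0_nondecreasing_set_cvg_integral => //.
- exact: nondecreasing_inner_itv.
- by move=> n; exact: measurable_itv.
- by move=> n; apply: measurable_funS mf; last exact: inner_itv_subset.
- by move=> n x /inner_itv_subset; exact: f0.
Qed.

Lemma cvg_integral_inner_itv (f : R -> \bar R) a b :
  mu.-integrable `]a, b[ f ->
  (\int[mu]_(x in inner_itv a b n) f x)%E @[n --> \oo] -->
  (\int[mu]_(x in `]a, b[) f x)%E.
Proof.
move=> fi; have mf := measurable_int _ fi.
rewrite integralE; under eq_cvg do rewrite integralE.
apply: cvgeB.
- by apply: fin_num_adde_defr; exact: integrable_pos_fin_num.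
- by apply: ge0_cvg_integral_inner_itv => //; exact: measurable_funepos.
- by apply: ge0_cvg_integral_inner_itv => //; exact: measurable_funeneg.
Qed.

Lemma continuous_FTC2_inner_itv f F a b : a < b ->
  {in `]a, b[, continuous f} ->
  {in `]a, b[, forall x : R, is_derive x 1 F (f x)} ->
  {within `[a, b], continuous F} ->
  (\int[mu]_(x in inner_itv a b n) (f x)%:E)%E @[n --> \oo] -->
  (F b - F a)%:E.
Proof.
move=> ab cf dF /(continuous_within_itvP _ ab)[cF Fa Fb].
pose u n := a + harmonic n; pose v n := b - harmonic n.
have ua : u n @[n --> \oo] --> a.
  rewrite -[X in _ --> X](addr0 a).
  by apply: cvgD; [exact: cvg_cst|exact: cvg_harmonic].
have vb : v n @[n --> \oo] --> b.
  rewrite -[X in _ --> X](subr0 b).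
  by apply: cvgB; [exact: cvg_cst|exact: cvg_harmonic].
have Fuv : (F (v n) - F (u n))%:E @[n --> \oo] --> (F b - F a)%:E.
  apply: cvg_EFin; first exact: nearW.
  apply: cvgB.
  - by move/cvg_at_leftP: Fb; apply; split => // n; rewrite gtrBl harmonic_gt0.
  - by move/cvg_at_rightP: Fa; apply; split => // n; rewrite ltrDl harmonic_gt0.
apply: cvg_trans Fuv; apply: near_eq_cvg; near=> n.
have uv : u n < v n.
  apply: (@lt_trans _ _ ((a + b) / 2)).
    by near: n; apply: (cvgr_lt _ ua); lra.
  by near: n; apply: (cvgr_gt _ vb); lra.
have sub : `[u n, v n] `<=` `]a, b[ := @inner_itv_subset a b n.
rewrite EFinB [RHS](@continuous_FTC2 _ f F)//.
- by apply: continuous_in_subspaceT => x /[!inE] /sub; exact: cf.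
- have : {within `[u n, v n], continuous F}.
    by apply: continuous_in_subspaceT => x /[!inE] /sub; exact: cF.
  move=> /(continuous_within_itvP _ uv)[_ Fu Fv].
  by split=> // x /subset_itv_oo_cc /sub /dF[].
- by move=> x /subset_itv_oo_cc /sub /dF dFx; rewrite derive1E derive_val.
Unshelve. all: by end_near. Qed.

Lemma ge0_continuous_FTC2oo f F a b : a < b ->
  {in `]a, b[, forall x, 0 <= f x} -> {in `]a, b[, continuous f} ->
  {in `]a, b[, forall x : R, is_derive x 1 F (f x)} ->
  {within `[a, b], continuous F} ->
  (\int[mu]_(x in `]a, b[) (f x)%:E = (F b - F a)%:E)%E.
Proof.
move=> ab f0 cf dF cF.
apply: cvg_unique (continuous_FTC2_inner_itv ab cf dF cF) => //.
apply: ge0_cvg_integral_inner_itv; last by move=> x /f0; rewrite lee_fin.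
apply/measurable_EFinP; apply: open_continuous_measurable_fun => // x.
by rewrite inE; exact: cf.
Qed.

Lemma integrable_continuous_FTC2oo f F a b : a < b ->
  mu.-integrable `]a, b[ (EFin \o f) -> {in `]a, b[, continuous f} ->
  {in `]a, b[, forall x : R, is_derive x 1 F (f x)} ->
  {within `[a, b], continuous F} ->
  (\int[mu]_(x in `]a, b[) (f x)%:E = (F b - F a)%:E)%E.
Proof.
move=> ab fi cf dF cF.
apply: cvg_unique (continuous_FTC2_inner_itv ab cf dF cF) => //.
exact: cvg_integral_inner_itv fi.
Qed.

End FTC_open_interval.

Fixpoint chebyshev_moment (F : fieldType) (n : nat) : F :=
  match n with
  | 0 => 1
  | 1 => 0
  | m.+2 => m.+1%:R / m.+2%:R * chebyshev_moment F m
  end.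

Lemma rmorph_chebyshev_moment (F K : fieldType) (f : {rmorphism F -> K}) n :
  f (chebyshev_moment F n) = chebyshev_moment K n.
Proof.
elim/ltn_ind: n => -[_|[_|n IH]] /=; [exact: rmorph1|exact: rmorph0|].
by rewrite rmorphM/= IH// fmorph_div !rmorph_nat.
Qed.

Lemma onem_sqr_gt0 (F : realDomainType) (t : F) : -1 < t < 1 -> 0 < 1 - t ^+ 2.
Proof. by move=> /andP[? ?]; nra. Qed.

Section ChebyshevMoments.
Context {R : realType}.
Notation mu := (@lebesgue_measure R).
Notation w := (@chebyshev_density R).
Notation I := (`](-1 : R), 1[%classic).
Implicit Types (t : R) (f : {poly R}).

Lemma within_continuous_asin : {within `[-1, 1], continuous (@asin R)}.
Proof.
have := @segment_can_le_continuous R (- (pi / 2)) (pi / 2) sin asin.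
rewrite sinN sin_pihalf; apply; last exact: sinK.
- by have := pi_gt0 R; lra.
- exact/continuous_subspaceT/continuous_sin.
Qed.

Lemma asin1 : asin 1 = pi / 2 :> R.
Proof.
have := @sinK R (pi / 2); rewrite sin_pihalf; apply.
by have := pi_gt0 R; rewrite in_itv/=; lra.
Qed.

Lemma asinN1 : asin (-1) = - (pi / 2) :> R.
Proof.
have := @sinK R (- (pi / 2)); rewrite sinN sin_pihalf; apply.
by have := pi_gt0 R; rewrite in_itv/=; lra.
Qed.

Lemma is_derive_expr n t :
  is_derive t 1 (@GRing.exp R ^~ n) (n%:R * t ^+ n.-1).
Proof.
apply: DeriveDef; first exact: exprn_derivable.
by rewrite exp_derive /GRing.scale/= mulr1.
Qed.

Lemma is_derive_sqrt_1B2 t : -1 < t < 1 ->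
  is_derive t 1 (fun x : R => Num.sqrt (1 - x ^+ 2))
    (- t / Num.sqrt (1 - t ^+ 2)).
Proof.
move=> t1; have t2 := onem_sqr_gt0 t1.
have dB := is_deriveB (is_derive_cst (1 : R) t 1) (is_derive_expr 2 t).
apply: is_derive_eq
  (@is_derive1_comp R Num.sqrt _ t _ _ (is_derive1_sqrt t2) dB) _.
by field; rewrite gt_eqF// sqrtr_gt0.
Qed.

Lemma continuous_sqrt_1B2 : continuous (fun t => Num.sqrt (1 - t ^+ 2)).
Proof.
move=> t; apply: (@continuous_comp _ _ _ (fun x : R => 1 - x ^+ 2) Num.sqrt).
  by apply: cvgB; [exact: cvg_cst|exact: exprn_continuous].
exact: sqrt_continuous.
Qed.

Lemma is_derive_expr_sqrt_1B2 n t : -1 < t < 1 ->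
  is_derive t 1 (fun x : R => x ^+ n * Num.sqrt (1 - x ^+ 2))
    ((n%:R * t ^+ n.-1 - n.+1%:R * t ^+ n.+1) / Num.sqrt (1 - t ^+ 2)).
Proof.
move=> t1; have t2 := onem_sqr_gt0 t1.
have s0 : Num.sqrt (1 - t ^+ 2) != 0 by rewrite gt_eqF// sqrtr_gt0.
apply: is_derive_eq (is_deriveM (is_derive_expr n t) (is_derive_sqrt_1B2 t1)) _.
rewrite /GRing.scale/=.
have -> a : Num.sqrt (1 - t ^+ 2) * a =
    (1 - t ^+ 2) / Num.sqrt (1 - t ^+ 2) * a.
  by rewrite -{2}(sqr_sqrtr (ltW t2)) expr2 mulfK.
move: (Num.sqrt _) s0 => s s0.
by case: n => [|n] /=; rewrite ?exprS -?natr1; field.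
Qed.

Lemma is_derive_chebyshev_density (F : R -> R) (c t : R) :
  is_derive t 1 F (c / Num.sqrt (1 - t ^+ 2)) ->
  is_derive t 1 (fun x => F x / pi) (c * w t).
Proof.
move=> dF; have -> : (fun x => F x / pi) = pi^-1 \*: F.
  by apply/funext => x; rewrite /GRing.scale/= mulrC.
by apply: is_derive_eq; rewrite /GRing.scale/= mulrC mulrA.
Qed.

Lemma chebyshev_density_ge0 t : 0 <= w t.
Proof. by rewrite divr_ge0 ?invr_ge0 ?sqrtr_ge0 ?pi_ge0. Qed.

Lemma continuous_chebyshev_density : {in `]-1, 1[, continuous w}.
Proof.
move=> t; rewrite in_itv/= => t1; apply: cvgMl; apply: cvgV.
  by rewrite gt_eqF// sqrtr_gt0 onem_sqr_gt0.
exact: continuous_sqrt_1B2.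
Qed.

Lemma integral_chebyshev_density : (\int[mu]_(t in I) (w t)%:E = 1)%E.
Proof.
rewrite (@ge0_continuous_FTC2oo _ _ (fun t => asin t / pi)).
- rewrite asin1 asinN1; congr EFin.
  by move: (pi : R) (lt0r_neq0 (pi_gt0 R)) => p p0; field.
- lra.
- by move=> t _; exact: chebyshev_density_ge0.
- exact: continuous_chebyshev_density.
- move=> t; rewrite in_itv/= => t1.
  rewrite -[w t]mul1r; apply: is_derive_chebyshev_density.
  by rewrite mul1r; exact: is_derive1_asin.
- by move=> t; apply: cvgMl; exact: within_continuous_asin.
Qed.

Lemma integrable_chebyshev_density : mu.-integrable I (EFin \o w).
Proof.
apply/integrableP; split.
  apply/measurable_EFinP; apply: open_continuous_measurable_fun => // t.
  by rewrite inE; exact: continuous_chebyshev_density.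
under eq_integral do rewrite gee0_abs ?lee_fin ?chebyshev_density_ge0//.
by rewrite integral_chebyshev_density ltry.
Qed.

Lemma integrable_expr_chebyshev n :
  mu.-integrable I (fun t => (t ^+ n * w t)%:E).
Proof.
have mX : measurable_fun I (fun t => t ^+ n).
  exact/measurable_funX/measurable_id.
have bX : [bounded (t : R) ^+ n | t in I].
  exists 1; split=> // M M1 t /=; rewrite in_itv/= -ltr_norml => t1.
  by rewrite normrX (le_trans _ (ltW M1))// exprn_ile1// ltW.
by have := @integrableMr _ _ R mu _ (measurable_itv _) _ _ mX bX
  integrable_chebyshev_density.
Qed.

Lemma Rintegral_expr_chebyshev_recurrence n :
  n%:R * (\int[mu]_(t in I) (t ^+ n.-1 * w t)) =
  n.+1%:R * (\int[mu]_(t in I) (t ^+ n.+1 * w t)).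
Proof.
have int_expr i (c : R) :
    mu.-integrable I (EFin \o (fun t => c * (t ^+ i * w t))).
  by have := @integrableZl _ _ R mu _ (measurable_itv _) c _
    (integrable_expr_chebyshev i).
apply/eqP; rewrite -subr_eq0 -!RintegralZl//;
  try exact: integrable_expr_chebyshev.
rewrite -RintegralB// /Rintegral (@integrable_continuous_FTC2oo _ _
  (fun t => t ^+ n * Num.sqrt (1 - t ^+ 2) / pi)).
- by rewrite sqrrN !expr1n subrr sqrtr0 !mulr0 !mul0r subrr.
- lra.
- by have := @integrableB _ _ R mu _ (measurable_itv _) _ _
    (int_expr n.-1 n%:R) (int_expr n.+1 n.+1%:R).
- move=> t t1; apply: cvgB; apply: cvgMr; apply: cvgM;
    by [exact: exprn_continuous|exact: continuous_chebyshev_density].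
- move=> t; rewrite in_itv/= => /(is_derive_expr_sqrt_1B2 n).
  by move=> /is_derive_chebyshev_density; rewrite mulrBl !mulrA.
- apply: continuous_subspaceT => t; apply: cvgMl.
  by apply: cvgM; [exact: exprn_continuous|exact: continuous_sqrt_1B2].
Qed.

Lemma Rintegral_expr_chebyshev n :
  \int[mu]_(t in I) (t ^+ n * w t) = chebyshev_moment R n.
Proof.
elim/ltn_ind: n => -[_|[_|n IH]] /=.
- under eq_Rintegral do rewrite mul1r.
  by rewrite /Rintegral integral_chebyshev_density.
- by have := Rintegral_expr_chebyshev_recurrence 0; rewrite mul0r mul1r.
- by rewrite -IH// mulrAC Rintegral_expr_chebyshev_recurrence mulrC mulKf.
Qed.

Lemma integral_poly_chebyshev f m : (size f <= m)%N ->
  (\int[mu]_(t in I) (f.[t] * w t)%:E =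
   (\sum_(i < m) f`_i * chebyshev_moment R i)%:E)%E.
Proof.
move=> fm.
transitivity (\int[mu]_(t in I)
    \sum_(i < m) (f`_i)%:E * (t ^+ i * w t)%:E)%E.
  apply: eq_integral => t _; rewrite (horner_coef_wide _ fm) mulr_suml -sumEFin.
  by apply: eq_bigr => i _; rewrite -mulrA EFinM.
rewrite integral_sum//; last first.
  by move=> i; apply: integrableZl => //; exact: integrable_expr_chebyshev.
rewrite -sumEFin; apply: eq_bigr => i _.
have int_i := integrable_expr_chebyshev i.
rewrite integralZl// EFinM -Rintegral_expr_chebyshev fineK//.
exact: integrable_fin_num.
Qed.

End ChebyshevMoments.

Definition chebyshev_power_sums (F : fieldType) (m : nat) (x : seq F) : Prop :=
  forall i, (i <= m)%N ->
    \sum_(y <- x) y ^+ i = (size x)%:R * chebyshev_moment F i.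

Lemma chebyshev_power_sums_map (F K : fieldType) (f : {rmorphism F -> K}) m x :
  chebyshev_power_sums m x -> chebyshev_power_sums m (map f x).
Proof.
move=> sum_x i im; rewrite big_map size_map.
under eq_bigr do rewrite -rmorphXn.
by rewrite -rmorph_sum sum_x// rmorphM rmorph_nat rmorph_chebyshev_moment.
Qed.

Lemma is_design_chebyshev (R : realType) m n (x : n.-tuple R) : (0 < n)%N ->
  uniq x -> {in x, forall y, -1 < y < 1} -> chebyshev_power_sums m x ->
  is_design (@chebyshev_density R) `](-1), 1[ m x.
Proof.
move=> n0 ux x1 sum_x; split=> // [i|f fm].
  by rewrite in_itv/= x1// mem_tnth.
have n_neq0 : n%:R != 0 :> R by rewrite pnatr_eq0 -lt0n.
rewrite (integral_poly_chebyshev fm); congr EFin.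
rewrite -(big_tuple _ _ x xpredT (horner f)).
under eq_bigr do rewrite (horner_coef_wide _ fm).
rewrite exchange_big mulr_sumr; apply: eq_bigr => i _.
rewrite -mulr_sumr sum_x; last by rewrite -ltnS.
by rewrite size_tuple mulrCA mulKf.
Qed.

Lemma is_design_chebyshev_ratr (R : realType) m n (x : n.-tuple rat) :
  (0 < n)%N -> uniq x -> {in x, forall y, -1 < y < 1} ->
  chebyshev_power_sums m x ->
  is_design (@chebyshev_density R) `](-1), 1[ m (map_tuple ratr x).
Proof.
move=> n0 ux x1 sum_x; apply: is_design_chebyshev => //=.
- by rewrite map_inj_uniq//; exact: fmorph_inj.
- move=> _ /mapP[y /x1 y1 ->].
  by rewrite -(rmorph1 (@ratr R)) -rmorphN !ltr_rat.
- exact: chebyshev_power_sums_map.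
Qed.

Section Symmetrize.
Variable F : realDomainType.
Implicit Type s : seq F.

Definition symmetrize s : seq F := 0 :: s ++ [seq - x | x <- s].

Lemma size_symmetrize s : size (symmetrize s) = (2 * size s + 1)%N.
Proof. by rewrite /= size_cat size_map addn1 mul2n addnn. Qed.

Lemma mem_symmetrize_opp s : symmetrize s =i [seq - x | x <- symmetrize s].
Proof.
move=> x; rewrite /symmetrize/= oppr0 map_cat (mapK (@opprK F)).
by rewrite !inE !mem_cat [in RHS](orbC (x \in _)).
Qed.

Lemma symmetrize_uniq s :
  uniq s -> {in s, forall x, 0 < x} -> uniq (symmetrize s).
Proof.
move=> us s0; rewrite /= cat_uniq (map_inj_uniq oppr_inj) us mem_cat/= andbT.
apply/andP; split.
  apply/norP; split; first by apply/negP => /s0; rewrite ltxx.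
  by apply/mapP => -[x /s0 x0 /eqP]; rewrite eq_sym oppr_eq0 gt_eqF.
apply/hasPn => _ /mapP[x /s0 x0 ->]; apply/negP => /s0.
by rewrite oppr_gt0 lt_gtF.
Qed.

Lemma symmetrize_bound s :
  {in s, forall x, 0 < x < 1} -> {in symmetrize s, forall x, -1 < x < 1}.
Proof.
move=> s01 x; rewrite inE mem_cat.
by move=> /or3P[/eqP ->|/s01|/mapP[y /s01 + ->]]; lra.
Qed.

Lemma sum_expr_symmetrize s i :
  \sum_(x <- symmetrize s) x ^+ i =
  0 ^+ i + (1 + (-1) ^+ i) * \sum_(x <- s) x ^+ i.
Proof.
rewrite big_cons big_cat big_map/= mulrDl mul1r mulr_sumr.
by congr (_ + (_ + _)); apply: eq_bigr => x _; exact: exprNn.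
Qed.

End Symmetrize.

Section HalfDesign.
Variable F : realFieldType.
Implicit Type s : seq F.

Record half_design s : Prop := HalfDesign {
  half_design_uniq : uniq s;
  half_design_bound : {in s, forall x, 0 < x < 1};
  half_design_sum2 :
    2 * \sum_(x <- s) x ^+ 2 = (2 * size s + 1)%:R * chebyshev_moment F 2;
  half_design_sum4 :
    2 * \sum_(x <- s) x ^+ 4 = (2 * size s + 1)%:R * chebyshev_moment F 4 }.

Lemma half_design_power_sums s :
  half_design s -> chebyshev_power_sums 5 (symmetrize s).
Proof.
case=> _ _ s2 s4 i; rewrite sum_expr_symmetrize size_symmetrize.
case: i => [|[|[|[|[|[|//]]]]]] _.
- rewrite big_const_seq count_predT iter_addr_0 /= !expr0 mulr1.
  by rewrite -mulr_natl natrD natrM; ring.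
- by rewrite /=; ring.
- by rewrite -s2; ring.
- by rewrite /=; ring.
- by rewrite -s4; ring.
- by rewrite /=; ring.
Qed.

End HalfDesign.

Section Hexagon.
Variable F : realFieldType.
Implicit Types (p q : F * F) (k x : F).

(* The positive projections of a regular hexagon inscribed in the unit circle
   are cos t, cos (pi/3 - t) and cos (pi/3 + t) with 0 < t < pi/6; p consists of
   the last two, whose sum is the first. *)
Definition hexagon p : seq F := [:: p.1 + p.2; p.1; p.2].

Definition hexagon_pair p : Prop :=
  [/\ 0 < p.2, p.2 < p.1 & p.1 ^+ 2 + p.1 * p.2 + p.2 ^+ 2 = 3 / 4].

Lemma hexagon_sum2 p : hexagon_pair p -> \sum_(x <- hexagon p) x ^+ 2 = 3 / 2.
Proof.
case: p => a b [/= _ _ ab]; rewrite !big_cons big_nil/=.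
have -> : 3 / 2 = 2 * (a ^+ 2 + a * b + b ^+ 2) by rewrite ab; field.
by ring.
Qed.

Lemma hexagon_sum4 p : hexagon_pair p -> \sum_(x <- hexagon p) x ^+ 4 = 9 / 8.
Proof.
case: p => a b [/= _ _ ab]; rewrite !big_cons big_nil/=.
have -> : 9 / 8 = 2 * (a ^+ 2 + a * b + b ^+ 2) ^+ 2 by rewrite ab; field.
by ring.
Qed.

Lemma hexagon_uniq p : hexagon_pair p -> uniq (hexagon p).
Proof.
case: p => a b [/= b0 ba _]; rewrite !inE !negb_or !andbT.
by apply/andP; split; [apply/andP; split|]; apply/eqP; lra.
Qed.

Lemma hexagon_bound p : hexagon_pair p -> {in hexagon p, forall x, 0 < x < 1}.
Proof.
case: p => a b [/= b0 ba ab] x; rewrite !inE/= => xab.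
have ab4 : a * b < 1 / 4.
  have : 0 < (a - b) ^+ 2 by rewrite exprn_gt0// subr_gt0.
  by nra.
have ab1 : a + b < 1 by rewrite -(@expr_lt1 _ 2) //; nra.
by move: xab => /or3P[]/eqP ->; lra.
Qed.

Lemma hexagon_pair_separated p : hexagon_pair p ->
  [/\ p.2 < 1 / 2, 1 / 2 < p.1, p.1 ^+ 2 < 3 / 4 & 3 / 4 < (p.1 + p.2) ^+ 2].
Proof. by case: p => a b [/= b0 ba ab]; split; nra. Qed.

Lemma hexagon_pair_inj p q x : hexagon_pair p -> hexagon_pair q ->
  x \in hexagon p -> x \in hexagon q -> p = q.
Proof.
move=> hp hq; have [] := hexagon_pair_separated hp.
have [] := hexagon_pair_separated hq.
case: p q hp hq => [a b] [c d] [/= b0 ba ab] [/= d0 dc cd].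
move=> d1 c1 c2 cd2 b1 a1 a2 ab2.
(* x^2 > 3/4, x > 1/2 and x < 1/2 tell the three positions apart. *)
rewrite !inE/= => /or3P[]/eqP -> /or3P[]/eqP e;
  try by exfalso; first [lra | rewrite e in ab2; lra | rewrite -e in cd2; lra].
- have : (a - b) ^+ 2 = (c - d) ^+ 2 by nra.
  move/eqP; rewrite eqrXn2 ?subr_ge0 ?ltW// => /eqP amb.
  have -> : a = c by lra.
  by have -> : b = d by lra.
- by rewrite -e in cd *; have -> : b = d by nra.
- by rewrite -e in cd *; have -> : a = c by nra.
Qed.

(* Here t = 2 arctan (sqrt 3 / k). *)
Definition hexagon_param k : F * F :=
  ((k ^+ 2 + 6 * k - 3) / (2 * (k ^+ 2 + 3)),
   (k ^+ 2 - 6 * k - 3) / (2 * (k ^+ 2 + 3))).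

Lemma hexagon_paramP k : 7 <= k -> hexagon_pair (hexagon_param k).
Proof.
move=> k7; have k3 : 0 < k ^+ 2 + 3 by nra.
split=> /=.
- by apply: divr_gt0; nra.
- by rewrite ltr_pM2r ?invr_gt0; lra.
- by field; rewrite gt_eqF.
Qed.

Lemma hexagon_param_inj : {in [pred k | 0 <= k] &, injective hexagon_param}.
Proof.
move=> k l; rewrite !inE => k0 l0 [e1 e2].
have k3 : 0 < k ^+ 2 + 3 by nra.
have l3 : 0 < l ^+ 2 + 3 by nra.
have : (k ^+ 2 - 3) / (k ^+ 2 + 3) = (l ^+ 2 - 3) / (l ^+ 2 + 3).
  transitivity ((hexagon_param k).1 + (hexagon_param k).2).
    by rewrite /=; field; rewrite gt_eqF.
  by rewrite /= e1 e2; field; rewrite gt_eqF.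
move/eqP; rewrite eqr_div ?(gt_eqF k3) ?(gt_eqF l3)// => /eqP e.
by apply/eqP; rewrite -(@eqrXn2 _ 2)//; apply/eqP; lra.
Qed.

(* The shift by 7 > 3 + 2 sqrt 3 ensures t < pi/6. *)
Definition rational_hexagon (n : nat) : seq F :=
  hexagon (hexagon_param (n + 7)%:R).

Lemma hexagon_pair_param_natr n : hexagon_pair (hexagon_param (n + 7)%:R).
Proof. by apply: hexagon_paramP; rewrite ler_nat leq_addl. Qed.

Lemma rational_hexagon_disjoint n m x :
  x \in rational_hexagon n -> x \in rational_hexagon m -> n = m.
Proof.
move=> xn xm.
have := hexagon_pair_inj (hexagon_pair_param_natr n)
  (hexagon_pair_param_natr m) xn xm.
move=> /hexagon_param_inj; rewrite !inE !ler0n => /(_ isT isT) /eqP.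
by rewrite eqr_nat eqn_add2r => /eqP.
Qed.

End Hexagon.

Lemma pairwise_disjoint_avoid (T : eqType) (h : nat -> seq T) (s : seq T) :
  (forall i j x, x \in h i -> x \in h j -> i = j) ->
  exists i, ~~ has (mem s) (h i).
Proof.
move=> disj; apply: contrapT => /forallNP meet.
have /choice[f fP] i : exists x, x \in h i /\ x \in s.
  by have /negP/negPn/hasP[x xi xs] := meet i; exists x.
have f_uniq : uniq [seq f i | i <- iota 0 (size s).+1].
  rewrite map_inj_uniq ?iota_uniq// => i j fij.
  by apply: (disj i j (f i)); [|rewrite fij]; exact: (fP _).1.
have /(uniq_leq_size f_uniq) :
    {subset [seq f i | i <- iota 0 (size s).+1] <= s}.
  by move=> _ /mapP[i _ ->]; exact: (fP i).2.
by rewrite size_map size_iota ltnn.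
Qed.

Section HalfDesignExistence.
Variable F : realFieldType.
Implicit Type s : seq F.

Lemma half_design_add3 s :
  half_design s -> exists2 t : seq F, half_design t & size t = (size s + 3)%N.
Proof.
case=> us bs s2 s4.
have [i si] := pairwise_disjoint_avoid s (@rational_hexagon_disjoint F).
have hi := hexagon_pair_param_natr F i.
exists (s ++ rational_hexagon F i); last by rewrite size_cat.
split; rewrite ?size_cat.
- by rewrite cat_uniq us si hexagon_uniq.
- by move=> x; rewrite mem_cat => /orP[/bs|/(hexagon_bound hi)].
- by rewrite big_cat mulrDr s2 hexagon_sum2//= !(natrD, natrM); field.
- by rewrite big_cat mulrDr s4 hexagon_sum4//= !(natrD, natrM); field.
Qed.

(* Found by computer search. *)
Definition numerators17 : seq nat :=
  [:: 3; 19; 21; 29; 39; 41; 45; 51; 67; 69; 71; 75; 77; 79; 81; 82; 83].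

Lemma half_design17 : half_design [seq a%:R / 84 : F | a <- numerators17].
Proof.
split; rewrite ?size_map.
- rewrite map_inj_uniq// => a b /(mulIf _) /eqP.
  by rewrite invr_eq0 pnatr_eq0 => /(_ isT); rewrite eqr_nat => /eqP.
- move=> _ /mapP[a a17 ->].
  have /andP[a0 a84] : (0 < a < 84)%N by move: a a17; apply/allP.
  by rewrite divr_gt0 ?ltr0n// ltr_pdivrMr ?ltr0n// mul1r ltr_nat.
- by rewrite big_map !big_cons big_nil/=; field.
- by rewrite big_map !big_cons big_nil/=; field.
Qed.

Lemma exists_half_design n :
  exists2 s : seq F, half_design s & size s = (17 + 3 * n)%N.
Proof.
elim: n => [|n [s /half_design_add3[t ht st] ss]].
  by eexists; first exact: half_design17.
by exists t => //; rewrite st ss mulnS addnAC addnA.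
Qed.

End HalfDesignExistence.

Theorem theorem8p2 (R : realType) (N : nat) (N_gt0 : (0 < N)%N)
    (N_mod6 : N = 5 %[mod 6]) (N_neq5 : N <> 5%N) (N_neq11 : N <> 11%N) :
  exists x : (2 * N + 1).-tuple R,
    [/\ is_design (@chebyshev_density R) `](-1), 1[ 5 x,
        rational_points x &
        antipodal x].
Proof.
have [n defN] : exists n, N = (17 + 3 * n)%N by exists ((N - 17) %/ 3)%N; lia.
have [s hs] := exists_half_design rat n; rewrite -defN => sN.
have [us s01 _ _] := hs.
have size_t : size (symmetrize s) == (2 * N + 1)%N.
  by rewrite size_symmetrize sN.
exists (map_tuple ratr (Tuple size_t)); split.
- apply: is_design_chebyshev_ratr; first by rewrite addn1.
  + by apply: symmetrize_uniq us _ => x /s01/andP[].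
  + exact: symmetrize_bound.
  + exact: half_design_power_sums hs.
- by move=> i; rewrite tnth_map; exists (tnth (Tuple size_t) i).
- move=> x /=; rewrite (eq_mem_map ratr (mem_symmetrize_opp s)) -!map_comp.
  by congr (_ \in _); apply: eq_map => y /=; rewrite rmorphN.
Qed.
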